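(* Let $d\ge 3$ be an integer. There exists $\epsilon_d>0$, depending only on $d$, such that, with probability tending to $1$ as $n\to\infty$ (over $n$ with $nd$ even), the random $d$-regular graph $\mathcal{G}_{n,d}$ satisfies $s^{*}_{d-3}(\mathcal{G}_{n,d})\ge \epsilon_d n$. In particular, $s^{*}_{d-3}(n,d)\ge\epsilon_d n$ for all sufficiently large $n$ with $nd$ even.
   Context: $\mathcal{G}_{n,d}$ is a graph chosen uniformly at random among all $d$-regular graphs on vertex set $\{1,\dots,n\}$. For a graph $G$ and a nonnegative integer $b$, the $(1:b)$ Maker--Breaker component game on $G$ is played as follows: two players, Maker and Breaker, alternately claim previously unclaimed (free) edges of $G$; Maker moves first, and on each move Maker claims one free edge and Breaker claims $b$ free edges (a player who cannot complete his quota claims all remaining free edges). The game ends when all edges are claimed. $s^{*}_{b}(G)$ denotes the largest integer $s$ such that Maker has a strategy guaranteeing that, at the end of the game, the graph formed by Maker's edges has a connected component with at least $s$ vertices. For $d\ge 3$, $s^{*}_{b}(n,d)=\max\{s^{*}_{b}(G): G \text{ is a } d\text{-regular graph on } n \text{ vertices}\}$. *)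

(* Defs.v *)
From HB Require Import structures.
From mathcomp Require Import all_boot all_order all_algebra.
From mathcomp Require Import boolp reals.

Set Implicit Arguments.
Unset Strict Implicit.
Unset Printing Implicit Defensive.

Import Order.TTheory GRing.Theory Num.Theory.

(** A simple graph on a finite vertex type [V] is given by its set of edges,
    each edge being a set of exactly two vertices. *)

Definition simple_graph (V : finType) (G : {set {set V}}) : bool :=
  [forall e in G, #|e| == 2].

Definition degree (V : finType) (G : {set {set V}}) (v : V) : nat :=
  #|[set e in G | v \in e]|.

Definition regular_graph (V : finType) (d : nat) (G : {set {set V}}) : bool :=
  simple_graph G && [forall v, degree G v == d].

Definition adjacent (V : finType) (G : {set {set V}}) : rel V :=
  [rel u v | [set u; v] \in G].

Definition component (V : finType) (G : {set {set V}}) (v : V) : {set V} :=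
  [set w | connect (adjacent G) v w].

Section Game.

Variables (V : finType) (G : {set {set V}}) (b : nat).

(** A round is the edge claimed by Maker together with the set of edges claimed
    by Breaker in reply; a history lists the completed rounds, oldest first. *)

Definition round : Type := ({set V} * {set {set V}})%type.
Definition history : Type := seq round.

Definition maker_edges (h : history) : {set {set V}} :=
  [set e in map fst h].

Definition breaker_edges (h : history) : {set {set V}} :=
  \bigcup_(r <- h) r.2.

Definition free_edges (h : history) : {set {set V}} :=
  G :\: (maker_edges h :|: breaker_edges h).

Definition strategy : Type := history -> {set V}.

(** The histories that can arise when Maker follows [S].  Breaker claims exactly
    [b] of the edges left free by Maker's move, or all of them if there are fewer
    than [b]. *)
Inductive play (S : strategy) : history -> Prop :=
| play_start : play S [::]
| play_round (h : history) (B : {set {set V}}) :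
    play S h -> free_edges h != set0 ->
    B \subset free_edges h :\ S h ->
    #|B| = minn b #|free_edges h :\ S h| ->
    play S (rcons h (S h, B)).

Definition legal_strategy (S : strategy) : Prop :=
  forall h, play S h -> free_edges h != set0 -> S h \in free_edges h.

Definition strategy_guarantees (S : strategy) (s : nat) : Prop :=
  forall h, play S h -> free_edges h = set0 ->
    exists v, s <= #|component (maker_edges h) v|.

Definition maker_can_guarantee (s : nat) : Prop :=
  exists S, legal_strategy S /\ strategy_guarantees S s.

(** No component has more than [#|V|] vertices, so the bound on [s] loses
    nothing; see [s_star_ge] and [s_starP]. *)
Definition s_star : nat :=
  \max_(s < #|V|.+1 | `[< maker_can_guarantee s >]) s.

End Game.

Definition regular_graphs (n d : nat) : {set {set {set 'I_n}}} :=
  [set G | regular_graph d G].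

Definition s_star_max (b n d : nat) : nat :=
  \max_(G in regular_graphs n d) s_star G b.

(** Probability of [P] under the uniform distribution on the [d]-regular graphs
    on [n] vertices; it is [0] by convention when there is no such graph. *)
Definition prob_regular (R : realType) (n d : nat)
    (P : pred {set {set 'I_n}}) : R :=
  (#|[set G in regular_graphs n d | P G]|%:R / #|regular_graphs n d|%:R)%R.
Arguments prob_regular : clear implicits.

Lemma free_edges_rcons (V : finType) (G : {set {set V}}) h e B :
  free_edges G (rcons h (e, B)) = (free_edges G h :\ e) :\: B.
Proof.
apply/setP => x; rewrite /free_edges /breaker_edges /maker_edges big_rcons /=.
rewrite !inE map_rcons mem_rcons in_cons /=.
by case: (x == e); case: (x \in B); case: (x \in map fst h);
  case: (x \in \bigcup_(r <- h) r.2); case: (x \in G).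
Qed.

(** So [strategy_guarantees] is never vacuous for a legal strategy. *)
Lemma complete_play (V : finType) (G : {set {set V}}) b S :
  legal_strategy G b S -> exists2 h, play G b S h & free_edges G h = set0.
Proof.
move=> leg.
suff H k : forall h, play G b S h -> #|free_edges G h| <= k ->
    exists2 h', play G b S h' & free_edges G h' = set0.
  exact: (H _ [::] (play_start _ _ _) (leqnn _)).
elim: k => [|k IH] h ph.
  by rewrite leqn0 cards_eq0 => /eqP h0; exists h.
have [h0 _|h0 hk] := eqVneq (free_edges G h) set0; first by exists h.
set F := free_edges G h :\ S h.
have [B BF cB] : exists2 B : {set {set V}}, B \subset F & #|B| = minn b #|F|.
  have lt : minn b #|F| <= size (enum F) by rewrite -cardE geq_minr.
  exists [set x in take (minn b #|F|) (enum F)].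
    by apply/subsetP => x; rewrite inE => /mem_take; rewrite mem_enum.
  rewrite cardsE (card_uniqP _) ?take_uniq ?enum_uniq // size_take.
  by move: lt; case: ltngtP.
apply: (IH (rcons h (S h, B))); first exact: play_round.
rewrite free_edges_rcons (leq_trans (subset_leq_card (subsetDl _ _))) //.
by rewrite -ltnS (leq_trans _ hk) // [X in _ <= X](cardsD1 (S h)) leg.
Qed.

Lemma s_star_ge (V : finType) (G : {set {set V}}) b s :
  maker_can_guarantee G b s -> s <= s_star G b.
Proof.
move=> ms; have sV : s < #|V|.+1.
  case: (ms) => S [/complete_play [h ph h0]] /(_ h ph h0) [v sv].
  by rewrite ltnS (leq_trans sv) // max_card.
by apply: (bigop.bigmax_sup (Ordinal sV)) => //; apply/asboolP.
Qed.

Lemma s_starP (V : finType) (G : {set {set V}}) b :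
  0 < #|V| -> maker_can_guarantee G b (s_star G b).
Proof.
case/card_gt0P => v _.
have m0 : `[< maker_can_guarantee G b (ord0 : 'I_#|V|.+1) >].
  apply/asboolP; exists (fun h => odflt set0 [pick e in free_edges G h]).
  split=> [h _ /set0Pn [e eF]|h _ _]; last by exists v.
  by case: pickP => //= /(_ e); rewrite eF.
rewrite /s_star (bigop.bigmax_eq_arg _ m0) //.
by case: arg_maxnP => // i /asboolP.
Qed.

(* Main.v *)
(** Maker grows the component [C] of a fixed vertex, always claiming a free edge
    that leaves [C].  After [k] rounds [C] has [k + 1] vertices and Breaker has
    taken at most [(d - 3) k] edges, while [d |C| - 2 e(C)] edges leave [C]; so
    Maker is never stuck as long as [2 e(S) < 3 |S|] for all small sets [S].

    In a random [d]-regular graph this holds for all [S] of size at most a small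
    multiple of [n], by a first-moment computation based on the bound
    [(2 d / n) ^ |F|] for the probability that a small edge set [F] is contained
    in the graph.  That bound comes from switchings: replacing the edges [uv] of
    [F] and [xy] by [ux] and [vy] can be done in at least [n d / 2] ways, and
    undone in at most [d ^ 2].  *)

Require Import Defs.
From mathcomp Require Import all_boot all_order all_algebra.
From mathcomp Require Import boolp reals zify lra.

Set Implicit Arguments.
Unset Strict Implicit.
Unset Printing Implicit Defensive.

Import Order.TTheory GRing.Theory Num.Theory.

(** * Maker's strategy: growing one component *)

Section Maker.
Local Open Scope nat_scope.
Variables (V : finType) (G : {set {set V}}).

Definition leaving (S : {set V}) : {set {set V}} :=
  [set e in G | (e :&: S != set0) && ~~ (e \subset S)].

Definition inside (S : {set V}) : {set {set V}} := [set e in G | e \subset S].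

Lemma degree_sumE v : degree G v = \sum_(e in G) (v \in e).
Proof.
rewrite /degree -sum1_card big_mkcond [RHS]big_mkcond /=.
by apply: eq_bigr => e _; rewrite inE; case: (e \in G); case: (v \in e).
Qed.

(** Double counting of incidences: an edge [e] contributes [#|e :&: S|] to the left side, which is 2
    for an edge inside [S], 1 for a leaving edge and 0 otherwise. *)
Lemma sum_degree_le (S : {set V}) : simple_graph G ->
  \sum_(v in S) degree G v <= 2 * #|inside S| + #|leaving S|.
Proof.
move=> /forall_inP sG; under eq_bigr do rewrite degree_sumE.
rewrite exchange_big /=.
have -> : 2 * #|inside S| + #|leaving S| =
  \sum_(e in G) (2 * (e \subset S) +
                 ((e :&: S != set0) && ~~ (e \subset S))).
  rewrite big_split -big_distrr /= -!sum1_card.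
  congr (2 * _ + _); rewrite big_mkcond [RHS]big_mkcond /=;
    apply: eq_bigr => e _; rewrite inE; case: (e \in G) => //=; by case: ifP.
apply: leq_sum => e eG.
have -> : \sum_(v in S) (v \in e) = #|e :&: S|.
  rewrite -sum1_card big_mkcond [RHS]big_mkcond /=; apply: eq_bigr => v _.
  by rewrite inE; case: (v \in S); case: (v \in e).
have /eqP e2 := sG e eG.
have := subset_leq_card (subsetIl e S); rewrite e2.
case: (boolP (e \subset S)) => /= eS; first by rewrite andbF; lia.
case: eqVneq => [->|_] /=; first by rewrite cards0.
have : #|e :&: S| < 2; last by lia.
rewrite -e2; apply: proper_card; rewrite properEneq subsetIl andbT.
by apply: contra eS => /eqP/setIidPl.
Qed.

Lemma component_mono (A B : {set {set V}}) v :
  A \subset B -> component A v \subset component B v.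
Proof.
move=> AB; apply/subsetP => w; rewrite !inE.
by apply: connect_sub => x y xy; apply: connect1; apply: (subsetP AB).
Qed.

Lemma component_stable (A : {set {set V}}) v (e : {set V}) :
  #|e| = 2 -> e \in A -> e :&: component A v != set0 -> e \subset component A v.
Proof.
move=> /eqP/cards2P [x [y [_ ->]]] eA /set0Pn [z].
have rxy : adjacent A x y by [].
have ryx : adjacent A y x by rewrite /adjacent /= setUC.
rewrite !inE => /andP [zxy vz]; apply/subsetP => t; rewrite !inE => txy.
apply: connect_trans vz _; move: zxy txy.
by do 2![case/orP => /eqP ->]; rewrite ?connect0 ?connect1.
Qed.

Variable b : nat.

(** When no free edge leaves the component, an arbitrary free edge keeps the strategy legal; the
    value [set0] occurs only when no edge is free. *)
Definition growing_move (v : V) : strategy V := fun h =>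
  let F := free_edges G h in
  if [pick e in F :&: leaving (component (maker_edges h) v)] is Some e then e
  else odflt set0 [pick e in F].

Lemma growing_move_legal v : legal_strategy G b (growing_move v).
Proof.
move=> h _ /set0Pn [e eF]; rewrite /growing_move.
case: pickP => [f fF|_] /=; first by move: fF; rewrite in_setI => /andP [].
by case: pickP => [//|/(_ e)] /=; rewrite eF.
Qed.

(** If every round so far has enlarged the component, at most [#|S| - 1] rounds are over when it
    equals [S], so [b * (#|S| - 1)] bounds the number of edges that Breaker holds. *)
Definition escaping (s : nat) : Prop := forall S : {set V},
  0 < #|S| <= s -> b * (#|S| - 1) < #|leaving S|.

Lemma card_breaker S h : play G b S h -> #|breaker_edges h| <= b * size h.
Proof.
elim=> [|h' B ph IH _ _ cB]; first by rewrite /breaker_edges big_nil cards0.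
rewrite /breaker_edges big_rcons /= size_rcons mulnS.
apply: leq_trans (leq_card_setU _ _) _; rewrite addnC.
by apply: leq_add; rewrite ?cB ?geq_minl.
Qed.

(** Breaker holds at most [b * size h] edges, too few to cover [leaving C]. An edge that he misses
    is not Maker's either, since a Maker edge meeting [C] lies inside [C]. *)
Lemma free_leaving v s h : simple_graph G -> escaping s ->
  play G b (growing_move v) h ->
  let C := component (maker_edges h) v in
  size h < #|C| <= s -> free_edges G h :&: leaving C != set0.
Proof.
move=> /forall_inP sG esc ph C /andP [hC Cs].
have C0 : 0 < #|C| <= s by rewrite Cs andbT; lia.
have lt : #|breaker_edges h| < #|leaving C|.
  apply: leq_ltn_trans (esc _ C0); apply: leq_trans (card_breaker ph) _.
  by rewrite leq_mul2l; apply/orP; right; lia.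
have /subsetPn [e eL eB] : ~~ (leaving C \subset breaker_edges h).
  by apply: contraL lt => /subset_leq_card; rewrite -leqNgt.
apply/set0Pn; exists e; rewrite inE eL andbT.
move: (eL); rewrite inE => /and3P [eG eC eNC].
rewrite inE inE (negbTE eB) orbF eG andbT.
by apply: contra eNC => eM; apply: component_stable => //; apply/eqP/sG.
Qed.

(** While [C] has at most [s] vertices, a free leaving edge exists and claiming it adds a vertex.
    Beyond [s] vertices monotonicity is enough, hence the minimum. *)
Lemma card_component_growing v s h : simple_graph G -> escaping s ->
  play G b (growing_move v) h ->
  minn s (size h) < #|component (maker_edges h) v|.
Proof.
move=> sG esc; elim=> [|h' B ph IH h0 sB cB].
  by rewrite minn0; apply/card_gt0P; exists v; rewrite inE connect0.
set C := component (maker_edges h') v in IH.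
set C' := component _ v.
set e := growing_move v h'.
have sub : maker_edges h' \subset maker_edges (rcons h' (e, B)).
  apply/subsetP => x; rewrite !inE map_rcons mem_rcons in_cons => ->.
  by rewrite orbT.
have CC' : C \subset C' by apply: component_mono.
have [Cs|Cs] := ltnP s #|C|.
  by have := subset_leq_card CC'; rewrite size_rcons; lia.
have hC : size h' < #|C| by lia.
have /set0Pn [f fL] : free_edges G h' :&: leaving C != set0.
  by apply: (free_leaving sG esc ph); rewrite hC.
have : e \in free_edges G h' :&: leaving C.
  by rewrite /e /growing_move; case: pickP => [//|/(_ f)]; rewrite fL.
rewrite inE => /andP [_]; rewrite inE => /and3P [eG eC eNC].
have eC' : e \subset C'.
  apply: component_stable.
  - by apply/eqP; move/forall_inP: sG; apply.
  - by rewrite inE map_rcons mem_rcons inE eqxx.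
  - by apply: contraNneq eC => e0; rewrite -subset0 -e0 setIS.
have : C \proper C'.
  rewrite properE CC' /=; apply: contra eNC => C'C.
  exact: subset_trans eC' C'C.
by move/proper_card; rewrite size_rcons; lia.
Qed.

Lemma escaping_s_star s : simple_graph G -> 0 < #|V| -> escaping s ->
  s < s_star G b.
Proof.
move=> sG /card_gt0P [v _] esc; apply: s_star_ge.
exists (growing_move v); split=> [|h ph h0]; first exact: growing_move_legal.
(* A final component with at most [s] vertices would still have a free leaving edge, although no
   edge is free. *)
exists v; rewrite ltnNge; apply/negP => Cs.
have := card_component_growing sG esc ph.
rewrite gtn_min ltnNge Cs /= => hC.
have := free_leaving sG esc ph => /=.
by rewrite hC Cs h0 set0I eqxx => /(_ isT).
Qed.

End Maker.

(** * Switchings and the probability of containing a small edge set *)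

Section Switching.
Local Open Scope nat_scope.
Variable V : finType.
Implicit Types (G F : {set {set V}}) (e : {set V}) (u v x y : V).

Definition neighbours G x : {set V} := [set y | [set x; y] \in G].

Lemma pair_neq G x y : simple_graph G -> [set x; y] \in G -> x != y.
Proof.
move=> /forall_inP sG /sG; rewrite cards2; by case: (x != y).
Qed.

Lemma card_neighbours G x : simple_graph G -> #|neighbours G x| = degree G x.
Proof.
move=> sG; rewrite /degree -(card_in_imset (f := fun y => [set x; y])).
  congr #|pred_of_set _|; apply/setP => e; rewrite inE.
  apply/imsetP/andP => [[y]|[eG xe]].
    by rewrite inE => xyG ->; rewrite !inE eqxx.
  move/forall_inP: (sG) => /(_ _ eG) /cards2P [a [b [_ eab]]].
  move: xe eG; rewrite eab !inE => /orP [] /eqP -> abG.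
    by exists b; rewrite ?inE.
  by exists a; rewrite ?inE setUC.
move=> y z; rewrite !inE => /(pair_neq sG) xy _ /setP /(_ y).
by rewrite !inE eqxx orbT eq_sym (negbTE xy) /= => /esym /eqP.
Qed.

Definition arcs G : {set V * V} := [set p | [set p.1; p.2] \in G].

Lemma card_arcs G : simple_graph G -> #|arcs G| = \sum_v degree G v.
Proof.
move=> sG; under eq_bigr do rewrite -card_neighbours // -sum1_card.
rewrite pair_big_dep -sum1_card /=; apply: eq_bigl => -[x y].
by rewrite !inE.
Qed.

Definition switch G u v x y : {set {set V}} :=
  [set u; x] |: ([set v; y] |: (G :\ [set u; v] :\ [set x; y])).

Definition switchable G u v x y : bool :=
  [&& [set u; v] \in G, [set x; y] \in G, x != u, x != v, y != u, y != v,
    [set u; x] \notin G & [set v; y] \notin G].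

Lemma set2_neq x y u v : x != u -> x != v -> ([set x; y] == [set u; v]) = false.
Proof.
move=> xu xv; apply/eqP => /setP /(_ x).
by rewrite !inE eqxx (negbTE xu) (negbTE xv).
Qed.

Lemma degree_setU1 G e w : e \notin G ->
  degree (e |: G) w = (w \in e) + degree G w.
Proof. by move=> eG; rewrite !degree_sumE big_setU1. Qed.

Lemma degree_setD1 G e w : e \in G ->
  degree G w = (w \in e) + degree (G :\ e) w.
Proof. by move=> eG; rewrite !degree_sumE (big_setD1 e). Qed.

(** Each of the four distinct vertices [u], [v], [x], [y] loses one edge and gains one; all other
    degrees stay the same. *)
Lemma switch_regular G d u v x y : switchable G u v x y -> regular_graph d G ->
  regular_graph d (switch G u v x y).
Proof.
move=> /and5P [uvG xyG xu xv /and4P [yu yv uxG vyG]] /andP [sG /forallP dG].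
have uv := pair_neq sG uvG; have xy := pair_neq sG xyG.
have uvxy : ([set x; y] == [set u; v]) = false by rewrite set2_neq.
apply/andP; split.
  apply/forall_inP => e; rewrite !inE => /or3P [/eqP ->|/eqP ->|].
  - by rewrite cards2 (eq_sym u) xu.
  - by rewrite cards2 (eq_sym v) yv.
  - by case/and3P => _ _ eG; move/forall_inP: sG; apply.
apply/forallP => w; rewrite -(eqP (dG w)) /switch.
rewrite (degree_setD1 w uvG).
rewrite (@degree_setD1 (G :\ [set u; v]) [set x; y]); last by rewrite !inE uvxy.
rewrite degree_setU1; last first.
  rewrite !inE (negbTE uxG) !andbF orbF set2_neq // eq_sym //.
rewrite degree_setU1; last by rewrite !inE (negbTE vyG) !andbF.
rewrite !addnA eqn_add2r !inE.
have [->|wu] := eqVneq w u.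
  by rewrite (negbTE uv) ![u == _]eq_sym (negbTE xu) (negbTE yu).
have [->|wv] := eqVneq w v.
  by rewrite ![v == _]eq_sym (negbTE xv) (negbTE yv).
have [->|wx] := eqVneq w x.
  by rewrite (negbTE xy).
by rewrite /= addnC.
Qed.

(** The switched graph together with the four vertices determines [G]; this is the injectivity
    behind the double count of switchings. *)
Lemma switchK G u v x y : switchable G u v x y ->
  [set u; v] |: ([set x; y] |:
    (switch G u v x y :\ [set u; x] :\ [set v; y])) = G.
Proof.
move=> /and5P [uvG xyG xu xv /and4P [yu yv uxG vyG]].
apply/setP => e; rewrite !inE.
case: eqVneq => [->|_] /=; first by rewrite uvG.
case: eqVneq => [->|_] /=; first by rewrite xyG.
case: eqVneq => [->|_] /=; first by rewrite (negbTE vyG).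
by case: eqVneq => [->|_] /=; first by rewrite (negbTE uxG).
Qed.


Lemma card_arcs_fst G d (A : {set V}) : regular_graph d G ->
  #|[set p in arcs G | p.1 \in A]| = #|A| * d.
Proof.
move=> /andP [sG /forallP dG]; rewrite -sum_nat_const.
rewrite (eq_bigr (fun x => \sum_(y in neighbours G x) 1)); last first.
  by move=> x _; rewrite sum1_card card_neighbours // (eqP (dG x)).
rewrite pair_big_dep -sum1_card /=; apply: eq_bigl => -[x y].
by rewrite !inE andbC.
Qed.

Lemma card_arcs_snd G d (A : {set V}) : regular_graph d G ->
  #|[set p in arcs G | p.2 \in A]| = #|A| * d.
Proof.
move=> rG; rewrite -(card_arcs_fst _ rG).
rewrite -(card_imset _ (can_inj (@swap_pairK V V))).
congr #|pred_of_set _|; apply/setP => -[x y]; apply/imsetP/idP.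
  by case=> -[x' y']; rewrite !inE /= setUC => H [-> ->].
by rewrite !inE /= => H; exists (y, x) => //; rewrite !inE /= setUC.
Qed.

Lemma card_arcs_le F : simple_graph F -> #|arcs F| <= 2 * #|F|.
Proof.
move=> sF; rewrite card_arcs //.
have := sum_degree_le [set: V] sF.
rewrite (eq_bigl predT) => [|v]; last by rewrite inE.
move=> /leq_trans; apply.
have -> : leaving F [set: V] = set0.
  by apply/setP => e; rewrite inE subsetT !andbF inE.
rewrite cards0 addn0 leq_mul2l /=; apply/subset_leq_card/subsetP => e.
by rewrite inE => /andP [].
Qed.

Definition extensions d F : {set {set {set V}}} :=
  [set G | regular_graph d G && (F \subset G)].

Definition switches G F u v : {set V * V} :=
  [set p | switchable G u v p.1 p.2 && ([set p.1; p.2] \notin F)].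

(** Of the [#|V| * d] arcs [(x, y)], the bad ones have their edge in [F], or [x] equal or adjacent
    to [u], or [y] equal or adjacent to [v]. Each of the last two classes has at most [d * d.+1]
    arcs. *)
Lemma card_switches G d F u v : regular_graph d G -> F \subset G ->
  [set u; v] \in F ->
  #|V| * d <= #|switches G F u v| + 2 * #|F| + 2 * (d * d.+1).
Proof.
move=> rG FG uvF; have [sG /forallP dG] := andP rG.
have uvG := subsetP FG _ uvF.
have sF : simple_graph F.
  apply/forall_inP => e eF; move/forall_inP: sG; apply; exact: (subsetP FG).
have cN x : #|x |: neighbours G x| * d <= d * d.+1.
  rewrite mulnC leq_mul2l; apply/orP; right; rewrite cardsU1.
  by rewrite card_neighbours // (eqP (dG x)); case: (x \notin _).
set Au := [set p in arcs G | p.1 \in u |: neighbours G u].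
set Av := [set p in arcs G | p.2 \in v |: neighbours G v].
have sub : arcs G \subset switches G F u v :|: arcs F :|: Au :|: Av.
  apply/subsetP => -[x y]; rewrite /Au /Av !inE /= => xyG.
  rewrite /switchable uvG xyG /=.
  have [xyF|_] := boolP ([set x; y] \in F); first by rewrite /= ?orbT.
  have [_|xu] /= := eqVneq x u; first by rewrite /= ?orbT.
  have [_|yv] /= := eqVneq y v; first by rewrite /= ?orbT.
  have [uxG|uxG] := boolP ([set u; x] \in G); first by rewrite /= ?orbT.
  have [vyG|vyG] := boolP ([set v; y] \in G); first by rewrite /= ?orbT.
  (* The two remaining inequalities are automatic: [x = v] would make [ux] the edge [uv] of [G], and
     [y = u] would do the same to [vy]. *)
  have -> : x != v by apply: contraNneq uxG => ->.
  by have -> : y != u by apply: contraNneq vyG => ->; rewrite setUC.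
have cG : #|arcs G| = #|V| * d.
  rewrite -cardsT -(card_arcs_fst _ rG); apply: eq_card => p.
  by rewrite !inE andbT.
have := subset_leq_card sub; rewrite cG => /leq_trans; apply.
have := (leq_card_setU (switches G F u v :|: arcs F :|: Au) Av).1.
have := (leq_card_setU (switches G F u v :|: arcs F) Au).1.
have := (leq_card_setU (switches G F u v) (arcs F)).1.
have hu : #|Au| <= d * d.+1 by rewrite (card_arcs_fst _ rG).
have hv : #|Av| <= d * d.+1 by rewrite (card_arcs_snd _ rG).
have := card_arcs_le sF; lia.
Qed.

Lemma card_dep_pair (T1 T2 : finType) (A : {set T1}) (B : T1 -> {set T2}) :
  #|[set q | (q.1 \in A) && (q.2 \in B q.1)]| = \sum_(x in A) #|B x|.
Proof.
under eq_bigr do rewrite -sum1_card.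
rewrite pair_big_dep -sum1_card /=; apply: eq_bigl => -[x y].
by rewrite !inE.
Qed.

(** Let [e] be [uv]. A switching destroys [uv] but no other edge of [F], so it leads from
    [extensions d F] to [extensions d (F :\ e)]. Each graph has at least [#|V| * d / 2] switchings;
    in the image [x] and [y] are neighbours of [u] and [v], which leaves [d * d] choices. *)
Lemma card_extensions_setD1 d F e : 0 < d -> #|e| = 2 -> e \in F ->
  4 * #|F| + 4 * (d * d.+1) <= #|V| * d ->
  #|V| * #|extensions d F| <= 2 * d * #|extensions d (F :\ e)|.
Proof.
move=> d0 /eqP/cards2P [u [v [_ ->]]] uvF hF.
set F' := F :\ _.
pose T := [set q | (q.1 \in extensions d F) && (q.2 \in switches q.1 F u v)].
pose T' := [set q | (q.1 \in extensions d F') &&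
  (q.2 \in setX (neighbours q.1 u) (neighbours q.1 v))].
have lT : #|extensions d F| * (#|V| * d) <= 2 * #|T|.
  rewrite /T (card_dep_pair _ (fun G => switches G F u v)).
  rewrite -sum_nat_const big_distrr /=; apply: leq_sum => G.
  (* The size hypothesis says that bad arcs make up at most half of all arcs. *)
  have arith a k f s : 4 * f + 4 * k <= a -> a <= s + 2 * f + 2 * k ->
    a <= 2 * s by lia.
  by rewrite inE => /andP [rG FG]; apply: arith hF (card_switches rG FG uvF).
have lT' : #|T'| = #|extensions d F'| * (d * d).
  rewrite /T' (card_dep_pair _
    (fun G => setX (neighbours G u) (neighbours G v))).
  rewrite -sum_nat_const; apply: eq_bigr => G.
  rewrite inE => /andP [/andP [sG /forallP dG] _].
  by rewrite cardsX !card_neighbours // !(eqP (dG _)).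
have TT' : #|T| <= #|T'|.
  pose f (q : {set {set V}} * (V * V)) := (switch q.1 u v q.2.1 q.2.2, q.2).
  rewrite -(card_in_imset (f := f)); last first.
    move=> [G [x y]] [G' [x' y']]; rewrite !inE /f /= => /andP [_ /andP [sw _]].
    move=> /andP [_ /andP [sw' _]] [eqG ex ey]; subst x' y'.
    by rewrite -(switchK sw) eqG (switchK sw').
  apply/subset_leq_card/subsetP => _ /imsetP [[G [x y]] + ->].
  rewrite !inE /= => /andP [/andP [rG FG] /andP [sw xyF]].
  rewrite (switch_regular sw rG) !eqxx /= orbT andbT.
  apply/subsetP => e'; rewrite !inE => /andP [euv eF].
  rewrite euv (subsetP FG) // !andbT; apply/or3P/Or33.
  by apply: contraNneq xyF => <-.
rewrite -(leq_pmul2r d0); lia.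
Qed.

(** Deleting the edges of [F] one at a time costs a factor [2 * d / #|V|] each; the size hypothesis
    is inherited by subsets of [F]. *)
Lemma card_extensions d F : 0 < d -> simple_graph F ->
  4 * #|F| + 4 * (d * d.+1) <= #|V| * d ->
  #|V| ^ #|F| * #|extensions d F| <= (2 * d) ^ #|F| * #|extensions d set0|.
Proof.
move=> d0; have [m] := ubnP #|F|; elim: m F => // m IH F.
have [->|/set0Pn [e eF]] := eqVneq F set0; first by rewrite cards0.
rewrite (cardsD1 e) eF add1n => Fm sF hF; rewrite !expnS.
have e2 : #|e| = 2 by apply/eqP; move/forall_inP: sF; apply.
have H1 : #|V| * #|extensions d F| <= 2 * d * #|extensions d (F :\ e)|.
  apply: card_extensions_setD1 => //.
  by rewrite (cardsD1 e) eF add1n.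
have H2 := IH (F :\ e) _ _ _.
apply: (@leq_trans (#|V| ^ #|F :\ e| * (2 * d * #|extensions d (F :\ e)|))).
  by rewrite mulnAC mulnC leq_mul2l H1 orbT.
rewrite mulnCA -[leqRHS]mulnA leq_mul2l; apply/orP; right; apply: H2; try lia.
apply/forall_inP => f; rewrite inE => /andP [_ fF].
by move/forall_inP: sF; apply.
Qed.

End Switching.

(** * Circulant graphs *)

Section Circulant.
Variable (V : finZmodType) (D : {set V}).
Hypotheses (D0 : 0%R \notin D) (DN : forall t, t \in D -> (- t)%R \in D).
Local Open Scope ring_scope.

Definition circulant : {set {set V}} :=
  [set [set p.1; p.1 + p.2] | p in setX [set: V] D].

(** An edge can be written from either endpoint: the reversed order is covered by the symmetry of
    [D], and [0] not being in [D] rules out the degenerate matchings. *)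
Lemma circulantP x y : ([set x; y] \in circulant) = (y - x \in D).
Proof.
apply/imsetP/idP => [[[a t]]|tD]; last first.
  by exists (x, y - x); rewrite ?inE //= addrC subrK.
rewrite !inE /= => tD E.
have ta : a + t != a.
  by apply: contraNneq D0 => /(canRL (addKr a)); rewrite addNr => <-.
have /orP xE : (x == a) || (x == a + t) by rewrite -in_set2 -E set21.
have /orP yE : (y == a) || (y == a + t) by rewrite -in_set2 -E set22.
have aE : (a == x) || (a == y) by rewrite -in_set2 E set21.
have tE : (a + t == x) || (a + t == y) by rewrite -in_set2 E set22.
case: xE yE => /eqP ex [] /eqP ey; subst x y.
- by move: tE; rewrite (negbTE ta).
- by rewrite addrC addKr.
- by rewrite opprD addNKr DN.
- by move: aE; rewrite eq_sym (negbTE ta).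
Qed.

Lemma circulant_regular : regular_graph #|D| circulant.
Proof.
have sC : simple_graph circulant.
  apply/forall_inP => e /imsetP [[x t]]; rewrite !inE /= => tD ->.
  rewrite cards2; suff -> : x != x + t by [].
  by apply: contraNneq D0 => /esym E; rewrite -[0](subrr x) -{1}E addrC addKr.
apply/andP; split=> //; apply/forallP => x.
rewrite -card_neighbours //.
have -> : neighbours circulant x = [set x + t | t in D].
  apply/setP => y; rewrite inE circulantP; apply/idP/imsetP.
    by move=> H; exists (y - x) => //; rewrite addrC subrK.
  by case=> t tD ->; rewrite addrC addKr.
by rewrite card_imset //; apply: addrI.
Qed.

End Circulant.

(** * Existence of regular graphs, so that the probability space is nonempty *)

Section Existence.
Local Open Scope nat_scope.

(** In the integers modulo [n.+1], take 1, ..., [k] and their opposites, with [k] half of [d]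
    rounded down. If [d] is odd, then [n.+1] is even and its half, which is its own opposite, is
    added. *)
Lemma symmetric_subset n d : d <= n -> ~~ odd (n.+1 * d) ->
  exists D : {set 'I_n.+1}, [/\ #|D| = d, 0%R \notin D &
    forall t, t \in D -> (- t)%R \in D].
Proof.
move=> dn par; pose k := d./2.
have kn : k.*2 <= n by rewrite /k; lia.
pose D1 : {set 'I_n.+1} := [set inord i.+1 | i : 'I_k].
have ltk (i : 'I_k) : i.+1 < n.+1 by have := ltn_ord i; lia.
have D1P t : (t \in D1) = (0 < t <= k).
  apply/imsetP/idP => [[i _ ->]|/andP [t0 tk]].
    by rewrite inordK // ltnS ltn_ord.
  have tk' : t.-1 < k by lia.
  by exists (Ordinal tk') => //=; apply/val_inj; rewrite /= inordK //; lia.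
have cD1 : #|D1| = k.
  rewrite card_imset ?card_ord // => i j /(congr1 val) /=.
  by rewrite !inordK // => -[/val_inj].
pose D2 : {set 'I_n.+1} := [set (- t)%R | t in D1].
have vN (t : 'I_n.+1) : 0 < t -> (- t)%R = n.+1 - t :> nat.
  by move=> t0; rewrite /= modn_small //; have := ltn_ord t; lia.
have D2P t : (t \in D2) = (n < t + k).
  apply/imsetP/idP => [[x + ->]|tk].
    by rewrite D1P => /andP [x0 xk]; rewrite vN //; lia.
  have t0 : 0 < t by lia.
  by exists (- t)%R; rewrite ?opprK // D1P vN //; have := ltn_ord t; lia.
have cD2 : #|D2| = k by rewrite card_imset //; exact: oppr_inj.
have D12N t : t \in D1 :|: D2 -> (- t)%R \in D1 :|: D2.
  rewrite !inE => /orP [H|/imsetP [x xD ->]].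
    by apply/orP; right; apply/imsetP; exists t.
  by rewrite opprK xD.
have cD12 : #|D1 :|: D2| = k.*2.
  rewrite cardsU cD1 cD2 -addnn.
  suff -> : D1 :&: D2 = set0 by rewrite cards0 subn0.
  by apply/setP => t; rewrite !inE D1P D2P; lia.
have D120 : 0%R \notin D1 :|: D2 by rewrite inE D1P D2P /=; lia.
have [od|ev] := boolP (odd d); last first.
  by exists (D1 :|: D2); split=> //; rewrite cD12 /k; lia.
have nodd : ~~ odd n.+1 by move: par; rewrite oddM od andbT.
pose h := inord (n.+1)./2 : 'I_n.+1.
have hE : h = (n.+1)./2 :> nat by rewrite inordK //; lia.
have h0 : 0 < h by rewrite hE; lia.
have hN : (- h)%R = h by apply: ord_inj; rewrite vN // hE; lia.
exists (h |: (D1 :|: D2)); split.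
- by rewrite cardsU1 cD12 in_setU D1P D2P hE /k; lia.
- by rewrite in_setU1 negb_or D120 andbT; apply/eqP => /(congr1 val) /=; lia.
- move=> t /setU1P [->|tD]; first by rewrite hN setU11.
  by rewrite in_setU1 D12N ?orbT.
Qed.

Lemma regular_graphs_neq0 n d : d < n -> ~~ odd (n * d) ->
  regular_graphs n d != set0.
Proof.
case: n => // n dn par; have [D [<- D0 DN]] := @symmetric_subset n d dn par.
by apply/set0Pn; exists (circulant D); rewrite inE circulant_regular.
Qed.

End Existence.

(** * Binomial estimates and the decay of the first-moment terms *)

Section Estimates.
Local Open Scope nat_scope.

Lemma ffact_le_exp n k : n ^_ k <= n ^ k.
Proof.
rewrite ffact_prod -[in n ^ k](card_ord k) -prod_nat_const.
by apply: leq_prod => i _; apply: leq_subr.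
Qed.

Lemma bin_le_exp2 n k : 'C(n, k) <= 2 ^ n.
Proof.
have := card_draws 'I_n k; rewrite card_ord => <-.
have := max_card [set A : {set 'I_n} | #|A| == k].
by rewrite -[X in _ <= X]cardsT -powersetT card_powerset cardsT card_ord.
Qed.

(** All [k] factors of the falling factorial [(2 * k) ^_ k] are at least [k], and it equals
    ['C(2 * k, k) * k!]. *)
Lemma exp_self_le_fact k : k ^ k <= 4 ^ k * k`!.
Proof.
apply: (@leq_trans ((2 * k) ^_ k)).
  rewrite ffact_prod -[X in _ ^ X](card_ord k) -prod_nat_const.
  by apply: leq_prod => i _; have := ltn_ord i; lia.
rewrite -bin_ffact leq_mul2r (_ : 4 = 2 ^ 2) // -expnM bin_le_exp2 orbT //.
Qed.

(** A division-free form of the bound [(4n/k)^k] on the binomial coefficient. *)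
Lemma bin_mul_exp_self_le n k : 'C(n, k) * k ^ k <= (4 * n) ^ k.
Proof.
apply: (@leq_trans ('C(n, k) * (4 ^ k * k`!))).
  by rewrite leq_mul2l exp_self_le_fact orbT.
by rewrite mulnCA bin_ffact expnMn leq_mul2l ffact_le_exp orbT.
Qed.

Lemma bin_pairs_le s m : s <= m -> 0 < m -> 'C('C(s, 2), m) <= (2 * s) ^ m.
Proof.
move=> sm m0; rewrite -(@leq_pmul2r (m ^ m)) ?expn_gt0 ?m0 //.
apply: leq_trans (bin_mul_exp_self_le _ _) _; rewrite -expnMn.
rewrite leq_exp2r // bin2.
have half4 x : 4 * x./2 <= 2 * x by have := odd_double_half x; lia.
apply: leq_trans (half4 _) _; rewrite -mulnA !leq_mul2l /=.
by rewrite (leq_trans (leq_pred s)) // orbT.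
Qed.

Lemma sum_geometric_le (x : nat -> nat) N k :
  (forall i, i < k -> 2 ^ i * x i <= N) -> \sum_(i < k) x i <= 2 * N.
Proof.
(* The extra [2 * N] is the tail of the geometric series, needed for the induction to go through. *)
move=> xN; suff: 2 ^ k * \sum_(i < k) x i + 2 * N <= 2 ^ k * (2 * N).
  move=> H; rewrite -(@leq_pmul2l (2 ^ k)) ?expn_gt0 //.
  exact: leq_trans (leq_addr _ _) H.
elim: k xN => [|k IH] xN; first by rewrite big_ord0 muln0 mul1n.
have {}IH := IH (fun i ik => xN i (ltnW ik)).
rewrite big_ord_recr /= expnS; move: (xN k (leqnn _)) IH.
by move: (2 ^ k) (\sum_(i < k) _) (x k) => a b c; nia.
Qed.

(* First-moment estimate for vertex sets of size [s] spanning [m >= 3s/2]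
   edges: [t / N] is at most [(4n/s)^s (4ds/n)^m], whose square is at most
   [(1024 d^3 s/n)^s]. *)
Lemma dense_term_sqr_le n d s m t N : 0 < s -> 0 < n -> 3 * s <= 2 * m ->
  4 * d * s <= n ->
  s ^ s * n ^ m * t <= (4 * n) ^ s * (4 * d * s) ^ m * N ->
  t ^ 2 * n ^ s <= (1024 * d ^ 3 * s) ^ s * N ^ 2.
Proof.
move=> s0 n0 sm dsn H.
(* Squaring turns the exponent [m] into [3 * s + k]; the surplus factor [(4ds/n)^k] is at most 1 and
   is dropped. *)
have [k mE] : exists k, 2 * m = 3 * s + k by exists (2 * m - 3 * s); lia.
have H2 : s ^ (2 * s) * n ^ (3 * s) * t ^ 2 <=
    (4 * n) ^ (2 * s) * (4 * d * s) ^ (3 * s) * N ^ 2.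
  rewrite -(@leq_pmul2r (n ^ k)) ?expn_gt0 ?n0 //.
  apply: (@leq_trans ((4 * n) ^ (2 * s) * (4 * d * s) ^ (2 * m) * N ^ 2)).
    have := H; rewrite -leq_sqr !expnMn -!expnM ![_ * 2]mulnC mE expnD.
    by congr (_ <= _); lia.
  rewrite mE expnD mulnA [leqLHS]mulnAC leq_mul2l; apply/orP; right.
  by case: (k) => // k'; rewrite leq_exp2r.
have P : 0 < s ^ (2 * s) * n ^ (2 * s) by rewrite muln_gt0 !expn_gt0 s0 n0.
rewrite -(leq_pmul2l P); move: H2.
have -> : n ^ (3 * s) = n ^ (2 * s) * n ^ s by rewrite -expnD; congr expn; lia.
have -> : (4 * n) ^ (2 * s) * (4 * d * s) ^ (3 * s) =
  s ^ (2 * s) * n ^ (2 * s) * (1024 * d ^ 3 * s) ^ s.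
  by rewrite !expnM -!expnMn; congr (_ ^ _); rewrite !expnS !expn0; lia.
by congr (_ <= _); lia.
Qed.

(** Put [K = 1024 * d ^ 3]. Of the [s] factors [Ks/n] bounding [(t/N)^2], all but one are replaced
    by 1/16. In the last one, [s] is at most [4 ^ s.-1] and [K/n] at most [1/A^2], so [(At/N)^2] is
    at most [4 ^ s.-1] inverted. *)
Lemma dense_term_le n d s t N A : 0 < d -> 0 < s -> 0 < n ->
  16 * (1024 * d ^ 3) * s <= n -> 1024 * d ^ 3 * A ^ 2 <= n ->
  t ^ 2 * n ^ s <= (1024 * d ^ 3 * s) ^ s * N ^ 2 ->
  2 ^ s.-1 * (A * t) <= N.
Proof.
move=> d0; case: s => // r _ n0 /=.
have K0 : 0 < 1024 * d ^ 3 by rewrite muln_gt0 expn_gt0 d0.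
move: (1024 * d ^ 3) K0 => K K0 hs hA; rewrite !(expnS _ r) => H.
have H16 : 16 ^ r * (K * r.+1) ^ r <= n ^ r.
  by rewrite -expnMn; case: (r) hs => // r' hs; rewrite leq_exp2r // mulnA.
have H1 : 16 ^ r * t ^ 2 * n <= K * r.+1 * N ^ 2.
  rewrite -(@leq_pmul2r (n ^ r)) ?expn_gt0 ?n0 //.
  apply: (@leq_trans (K * r.+1 * N ^ 2 * (16 ^ r * (K * r.+1) ^ r)));
    last by rewrite leq_mul2l H16 orbT.
  have : 16 ^ r * (t ^ 2 * (n * n ^ r)) <=
    16 ^ r * (K * r.+1 * (K * r.+1) ^ r * N ^ 2) by rewrite leq_mul2l H orbT.
  by congr (_ <= _); lia.
have r4 : r.+1 <= 4 ^ r by apply: ltn_expl.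
have H2 : 4 ^ r * t ^ 2 * n <= K * N ^ 2.
  rewrite -(@leq_pmul2l (4 ^ r)) ?expn_gt0 //.
  apply: (@leq_trans (K * r.+1 * N ^ 2)).
    by apply: leq_trans H1; rewrite (_ : 16 = 4 * 4) // expnMn !mulnA.
  by rewrite [leqRHS]mulnA leq_mul2r [leqRHS]mulnC leq_mul2l r4 !orbT.
rewrite -leq_sqr -(leq_pmul2l K0); apply: leq_trans H2.
have -> : 4 ^ r = (2 ^ r) ^ 2 by rewrite -!expnM mulnC expnM.
rewrite !expnMn.
have -> : K * ((2 ^ r) ^ 2 * (A ^ 2 * t ^ 2)) =
  (2 ^ r) ^ 2 * t ^ 2 * (K * A ^ 2) by lia.
by rewrite leq_mul2l hA orbT.
Qed.

End Estimates.

(** * Union bound over small dense vertex sets *)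

Section UnionBound.
Local Open Scope nat_scope.

Lemma subset_of_card (T : finType) (A : {set T}) k : k <= #|A| ->
  exists2 B : {set T}, B \subset A & #|B| = k.
Proof.
case/card_geqP => s [us <- sA]; exists [set x in s].
  by apply/subsetP => x; rewrite inE => /sA.
by rewrite cardsE (card_uniqP us).
Qed.

Lemma card_bigcup_le (I T : finType) (P : pred I) (F : I -> {set T}) :
  #|\bigcup_(i | P i) F i| <= \sum_(i | P i) #|F i|.
Proof.
elim/big_rec2: _ => [|i k A _ H]; first by rewrite cards0.
by apply: leq_trans (leq_card_setU _ _).1 _; rewrite leq_add2l.
Qed.

Variables (n d : nat).
Hypotheses (d3 : 3 <= d) (n0 : 0 < n).

Definition pairs (S : {set 'I_n}) : {set {set 'I_n}} :=
  [set e : {set 'I_n} | (e \subset S) && (#|e| == 2)].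

Definition dense_edge_sets (S : {set 'I_n}) : {set {set {set 'I_n}}} :=
  [set F : {set {set 'I_n}} |
    (F \subset pairs S) && (#|F| == uphalf (3 * #|S|))].

Lemma card_dense_edge_sets S :
  #|dense_edge_sets S| = 'C('C(#|S|, 2), uphalf (3 * #|S|)).
Proof. by rewrite /dense_edge_sets cards_draws /pairs cards_draws. Qed.

Lemma dense_edge_sets_simple S F : F \in dense_edge_sets S -> simple_graph F.
Proof.
rewrite inE => /andP [/subsetP FS _]; apply/forall_inP => e /FS.
by rewrite inE => /andP [].
Qed.

(** If at most [(d - 3) * (#|S| - 1)] edges leave [S], the degree sum [d * #|S|] forces twice the
    number of inside edges to be at least [3 * #|S|]. Keeping exactly [uphalf (3 * #|S|)] of them
    gives [F]. *)
Lemma not_escaping_dense (G : {set {set 'I_n}}) s : regular_graph d G ->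
  ~ escaping G (d - 3) s ->
  exists2 S : {set 'I_n}, 0 < #|S| <= s &
    exists2 F, F \in dense_edge_sets S & F \subset G.
Proof.
move=> /andP [sG /forallP dG] /existsNP [S /not_implyP [hS /negP]].
rewrite -leqNgt => hL; exists S => //.
have := sum_degree_le S sG.
rewrite (eq_bigr (fun=> d)) => [|v _]; last exact/eqP.
rewrite sum_nat_const => hD.
have [F FS cF] : exists2 F : {set {set 'I_n}},
    F \subset inside G S & #|F| = uphalf (3 * #|S|).
  apply: subset_of_card; rewrite leq_uphalf_double.
  have [c dE] : exists c, d = c + 3 by exists (d - 3); lia.
  move: hL hD; rewrite dE addnK -mul2n.
  by move: (#|S|) (#|leaving G S|) (#|inside G S|) hS => a b i; nia.
exists F; last first.
  by apply: subset_trans FS _; apply/subsetP => e; rewrite inE => /andP [].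
rewrite inE cF eqxx andbT; apply: subset_trans FS _; apply/subsetP => e.
rewrite !inE => /andP [eG ->] /=.
by move/forall_inP: sG; apply.
Qed.

(** The largest set size for which the ratio [1024 * d ^ 3 * s / n] is at most 1/16, as the
    geometric decay requires. *)
Definition escape_radius : nat := n %/ (16 * (1024 * d ^ 3)).

Definition non_escaping : {set {set {set 'I_n}}} :=
  [set G in regular_graphs n d | ~~ `[< escaping G (d - 3) escape_radius >]].

Definition dense_weight (s : nat) : nat :=
  \sum_(S : {set 'I_n} | #|S| == s)
    \sum_(F in dense_edge_sets S) #|extensions d F|.

Lemma card_non_escaping_sum :
  #|non_escaping| <= \sum_(i < escape_radius) dense_weight i.+1.
Proof.
pose U (i : 'I_escape_radius) : {set {set {set 'I_n}}} :=
  \bigcup_(S : {set 'I_n} | #|S| == i.+1)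
    \bigcup_(F in dense_edge_sets S) extensions d F.
have sub : non_escaping \subset \bigcup_i U i.
  apply/subsetP => G; rewrite !inE => /andP [rG /asboolPn].
  move=> /(not_escaping_dense rG) [S /andP [S0 Ss] [F FS FG]].
  have iS : #|S|.-1 < escape_radius by rewrite prednK.
  apply/bigcupP; exists (Ordinal iS) => //.
  apply/bigcupP; exists S; first by rewrite /= prednK.
  by apply/bigcupP; exists F => //; rewrite inE rG.
apply: leq_trans (subset_leq_card sub) _.
apply: leq_trans (card_bigcup_le _ _) _; apply: leq_sum => i _.
apply: leq_trans (card_bigcup_le _ _) _; apply: leq_sum => S _.
exact: card_bigcup_le.
Qed.

Hypothesis nd : 2 * (d * d.+1) <= n.

(** There are at most [(4n/s)^s] sets [S], at most [(2s)^m] edge sets [F] in each, and every [F] is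
    contained in a fraction at most [(2d/n)^m] of the regular graphs. *)
Lemma dense_weight_le s m : 0 < s <= escape_radius -> m = uphalf (3 * s) ->
  s ^ s * n ^ m * dense_weight s <=
  (4 * n) ^ s * (4 * d * s) ^ m * #|regular_graphs n d|.
Proof.
move=> /andP [s0 sr] mE.
have d0 : 0 < d by lia.
have sm : s <= m <= 2 * s by lia.
have hs : 16 * (1024 * d ^ 3) * s <= n.
  rewrite mulnC; apply: leq_trans (leq_divM n (16 * (1024 * d ^ 3))).
  by rewrite leq_mul2r sr orbT.
have h8 : 8 * s <= n.
  have : 0 < d ^ 3 by rewrite expn_gt0 d0.
  by move: (d ^ 3) hs => c; nia.
have reg0 : extensions d set0 = regular_graphs n d.
  by apply/setP => G; rewrite !inE sub0set andbT.
have H (S F : {set _}) : #|S| == s -> F \in dense_edge_sets S ->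
    n ^ m * #|extensions d F| <= (2 * d) ^ m * #|regular_graphs n d|.
  move=> /eqP cS FS; have sF := dense_edge_sets_simple FS.
  move: FS; rewrite inE cS => /andP [_ /eqP cF].
  have := @card_extensions _ d F d0 sF; rewrite card_ord cF -mE reg0; apply.
  (* Here [4 * m <= 8 * s <= n] and [4 * (d * d.+1) <= 2 * n], and the total [3 * n] is at most
     [n * d]. *)
  by nia.
set N := #|regular_graphs n d|.
have W : n ^ m * dense_weight s <=
    'C(n, s) * ('C('C(s, 2), m) * ((2 * d) ^ m * N)).
  have -> : 'C(n, s) = #|[set S : {set 'I_n} | #|S| == s]|.
    by rewrite card_draws card_ord.
  rewrite cardsE -sum_nat_const big_distrr /=; apply: leq_sum => S cS.
  rewrite mE -(eqP cS) -card_dense_edge_sets -sum_nat_const big_distrr /=.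
  by apply: leq_sum => F FS; rewrite (eqP cS) -mE; apply: H FS.
rewrite -mulnA; apply: leq_trans (leq_mul (leqnn _) W) _.
rewrite mulnA [_ * 'C(n, s)]mulnC -[leqRHS]mulnA.
apply: leq_mul; first exact: bin_mul_exp_self_le.
rewrite mulnA leq_mul2r; apply/orP; right.
rewrite (_ : 4 * d * s = (2 * s) * (2 * d)); last lia.
rewrite [leqRHS]expnMn leq_mul2r bin_pairs_le ?orbT //; lia.
Qed.

Lemma card_non_escaping A : 1024 * d ^ 3 * A ^ 2 <= n ->
  A * #|non_escaping| <= 2 * #|regular_graphs n d|.
Proof.
move=> hA; apply: leq_trans (leq_mul (leqnn A) card_non_escaping_sum) _.
rewrite big_distrr /=.
apply: (sum_geometric_le (x := fun i => A * dense_weight i.+1)) => i ir.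
have d0 : 0 < d by lia.
have hs : 16 * (1024 * d ^ 3) * i.+1 <= n.
  rewrite mulnC; apply: leq_trans (leq_divM n (16 * (1024 * d ^ 3))).
  by rewrite leq_mul2r ir orbT.
have h4 : 4 * d * i.+1 <= n.
  apply: leq_trans hs; rewrite leq_mul2r; apply/orP; right.
  have : d <= d ^ 3 by rewrite -{1}[d]expn1 leq_pexp2l.
  lia.
apply: (@dense_term_le n d i.+1) => //.
apply: (@dense_term_sqr_le n d i.+1 (uphalf (3 * i.+1))) => //; first lia.
exact: (@dense_weight_le i.+1 _ ir).
Qed.

End UnionBound.

(** * From counting to probabilities *)

Section Probability.
Local Open Scope ring_scope.

Lemma escape_radius_s_star n d (G : {set {set 'I_n}}) :
  (0 < d)%N -> (0 < n)%N ->
  G \in regular_graphs n d -> G \notin non_escaping n d ->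
  (n <= 16 * (1024 * d ^ 3) * s_star G (d - 3))%N.
Proof.
move=> d0 n0 rG; rewrite inE rG negbK => /asboolP esc.
have sG : simple_graph G by move: rG; rewrite inE => /andP [].
have := escaping_s_star sG _ esc; rewrite card_ord => /(_ n0) Hs.
(* The strict inequality between [escape_radius] and [s_star] makes up for rounding down in the
   quotient. *)
apply: (@leq_trans (16 * (1024 * d ^ 3) * (escape_radius n d).+1)%N).
  by rewrite mulnC ltnW // ltn_ceil // 2!muln_gt0 expn_gt0 d0.
by rewrite leq_mul2l Hs orbT.
Qed.

Lemma prob_regular_ge (R : realType) n d A (P : pred {set {set 'I_n}}) :
  (0 < A)%N -> regular_graphs n d != set0 ->
  (A * #|non_escaping n d| <= 2 * #|regular_graphs n d|)%N ->
  (forall G, G \in regular_graphs n d -> G \notin non_escaping n d -> P G) ->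
  1 - 2 / A%:R <= prob_regular R n d P <= 1.
Proof.
move=> A0 N0 bad good; rewrite /prob_regular.
set g := #|_|; set N := #|regular_graphs n d| in bad *.
have N_gt0 : 0 < N%:R :> R by rewrite ltr0n card_gt0.
have A_gt0 : 0 < A%:R :> R by rewrite ltr0n.
have gN : (g <= N)%N.
  by apply/subset_leq_card/subsetP => G; rewrite inE => /andP [].
have Ng : (N <= g + #|non_escaping n d|)%N.
  apply: leq_trans (leq_card_setU [set G in regular_graphs n d | P G] _).1.
  apply/subset_leq_card/subsetP => G rG.
  rewrite in_setU; case: (boolP (G \in non_escaping n d)) => [|bG].
    by rewrite orbT.
  by rewrite inE rG good.
rewrite ler_pdivrMr // mul1r ler_nat gN andbT ler_pdivlMr //.
rewrite -(ler_pM2l A_gt0) mulrA mulrBr mulr1 mulrCA divff ?gt_eqF // mulr1.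
rewrite mulrBl lerBlDr -!natrM -natrD ler_nat.
move: bad Ng; set b := #|non_escaping n d| => bad Ng.
apply: leq_trans (leq_add (leqnn _) bad); rewrite -mulnDr.
by rewrite leq_mul2l Ng orbT.
Qed.

Lemma prob_regular_gt0 (R : realType) n d (P : pred {set {set 'I_n}}) :
  0 < prob_regular R n d P -> exists2 G, G \in regular_graphs n d & P G.
Proof.
have [E|/set0Pn [G]] := eqVneq [set G in regular_graphs n d | P G] set0.
  by rewrite /prob_regular E cards0 mul0r ltxx.
by rewrite inE => /andP [rG PG]; exists G.
Qed.

End Probability.

(* Passage to the limit *)
From mathcomp Require Import classical_sets filter topology normedtype sequences.
Import numFieldNormedType.Exports.
Local Open Scope classical_set_scope.
Local Open Scope ring_scope.

Theorem theorem1p4 (R : realType) (d : nat) (hd : (3 <= d)%N) :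
  exists eps : R, 0 < eps /\
    (prob_regular R n d (fun G => eps * n%:R <= (s_star G (d - 3))%:R)
       @[n --> within [set n : nat | ~~ odd (n * d)] \oo] --> (1 : R)) /\
    (\forall n \near \oo, ~~ odd (n * d) ->
       eps * n%:R <= (s_star_max (d - 3) n d)%:R).
Proof.
have d0 : (0 < d)%N by apply: leq_trans hd.
pose K := (16 * (1024 * d ^ 3))%N.
have K0 : (0 < K)%N by rewrite 2!muln_gt0 expn_gt0 d0.
have K_gt0 : 0 < K%:R :> R by rewrite ltr0n.
have epsE n s : (K%:R^-1 * n%:R <= s%:R :> R) = (n <= K * s)%N.
  by rewrite ler_pdivrMl // -natrM ler_nat.
pose big A n := [&& 0 < n, d < n, 2 * (d * d.+1) <= n &
  1024 * d ^ 3 * A ^ 2 <= n]%N.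
have big_near A : \forall n \near \oo, big A n.
  exists (maxn d.+1 (maxn (2 * (d * d.+1)) (1024 * d ^ 3 * A ^ 2)))%N => //.
  by move=> n /=; rewrite /big !geq_max => /and3P [dn -> ->]; rewrite dn; lia.
have bound A n : (0 < A)%N -> big A n -> ~~ odd (n * d) ->
    1 - 2 / A%:R <= prob_regular R n d
      (fun G => K%:R^-1 * n%:R <= (s_star G (d - 3))%:R :> R) <= 1.
  move=> A0 /and4P [n0 dn hn hA] par; apply: (@prob_regular_ge R n d A) => //.
  - exact: regular_graphs_neq0.
  - exact: card_non_escaping.
  - by move=> G rG bG; rewrite epsE escape_radius_s_star.
exists K%:R^-1; split; first by rewrite invr_gt0.
split.
  apply/cvgrPdist_lt => e e0; rewrite near_withinE.
  (* The failure probability is at most [2 / A], so any integer [A] above [2 / e] will do. *)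
  pose A := (Num.truncn (2 / e)).+1.
  have Ae : 2 / A%:R < e.
    by rewrite ltr_pdivrMr ?ltr0n // mulrC -ltr_pdivrMr // truncnS_gt.
  apply: filterS (big_near A) => n bn par.
  have /andP [lo hi] := bound A n isT bn par.
  by rewrite ger0_norm ?subr_ge0 // (le_lt_trans _ Ae) // lerBlDl -lerBlDr.
(* With [A = 3] the probability is at least 1/3, hence positive, so some regular graph attains the
   bound. *)
apply: filterS (big_near 3) => n bn par.
have /andP [lo _] := bound 3 n isT bn par.
have [G rG hG] : exists2 G, G \in regular_graphs n d &
    K%:R^-1 * n%:R <= (s_star G (d - 3))%:R :> R.
  by apply: (@prob_regular_gt0 R); apply: lt_le_trans lo; lra.
apply: le_trans hG _; rewrite ler_nat.
exact: (bigop.bigmax_sup G).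
Qed.
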